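(* Let $k\geq 2$ be an integer and let $G$ be a finitely separable graph. Then $G$ is $k$-Tutte-connected if and only if its finite-cycle matroid $M_{\rm FC}(G)$ is $k$-connected.
   Context: Graphs may be infinite. A graph is finitely separable if any two vertices can be separated by deleting finitely many edges. For $X\subseteq E(G)$, $V[X]$ denotes the set of vertices incident with an edge of $X$. For an integer $\ell$, an $\ell$-Tutte-separation of $G$ is a partition $(X,Y)$ of $E(G)$ with $|X|,|Y|\geq \ell$ and $|V[X]\cap V[Y]|\leq \ell$; $G$ is $k$-Tutte-connected if it has no $\ell$-Tutte-separation for any $\ell<k$. Matroids may be infinite: a matroid on a set $E$ is given by a family $\mathcal I\subseteq 2^E$ of independent sets satisfying (I1) $\emptyset\in\mathcal I$; (I2) $\mathcal I$ is closed under subsets; (I3) for every non-maximal $I\in\mathcal I$ and every maximal $I'\in\mathcal I$ there is $x\in I'\setminus I$ with $I\cup\{x\}\in\mathcal I$; (IM) whenever $I\subseteq X\subseteq E$ and $I\in\mathcal I$, the set $\{I'\in\mathcal I: I\subseteq I'\subseteq X\}$ has a maximal element. Bases are maximal independent sets; $M|X$ is the restriction to $X$ and $M\setminus X=M|(E\setminus X)$. The connectivity function is defined as follows: for $X\subseteq E$ choose a basis $B$ of $M|X$, a basis $B'$ of $M\setminus X$, and $F\subseteq B\cup B'$ such that $(B\cup B')\setminus F$ is a basis of $M$; then $\kappa_M(X):=|F|\in\mathbb N\cup\{\infty\}$ (all infinite cardinalities identified with $\infty$); this is independent of the choices. A partition $(X,Y)$ of $E$ is an $\ell$-separation if $\kappa_M(X)\leq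 \ell-1$ and $|X|,|Y|\geq\ell$; $M$ is $k$-connected if it has no $\ell$-separation with $\ell<k$. The finite-cycle matroid $M_{\rm FC}(G)$ is the matroid on $E(G)$ whose independent sets are the edge sets not containing the edge set of any finite cycle of $G$. *)

(* Defs.v *)
From mathcomp Require Import all_boot all_order all_algebra.
From mathcomp Require Import finmap.
From mathcomp Require Import boolp classical_sets functions cardinality.
From mathcomp Require Import constructive_ereal.

Set Implicit Arguments.
Unset Strict Implicit.
Unset Printing Implicit Defensive.

Local Open Scope classical_set_scope.

(* All infinite cardinalities are identified with +oo. *)
Definition ecard (T : choiceType) (A : set T) : \bar int :=
  if pselect (finite_set A) then (#|` fset_set A|%fset%:Z)%:E else +oo%E.

(* Nonemptiness only matters for l-separations with l <= 0: it follows from the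
   size bounds when l >= 1, while (set0, setT) would otherwise be a
   0-Tutte-separation of every graph. *)
Definition partition2 (T : Type) (X Y : set T) : Prop :=
  [/\ X !=set0, Y !=set0, X `|` Y = setT & X `&` Y = set0].

Definition maximal (T : Type) (F : set (set T)) (A : set T) : Prop :=
  F A /\ forall B, F B -> A `<=` B -> B = A.

(* Possibly infinite multigraphs; loops have ends e = [set u; u]. *)
Record graph := Graph {
  vertex : choiceType;
  edge : choiceType;
  ends : edge -> set vertex;
  ends_pair : forall e, exists u v, ends e = [set u; v] }.

Section Graphs.
Variable G : graph.
Implicit Types (x y u v : vertex G) (e : edge G) (A X Y : set (edge G)).
Implicit Types p : seq (edge G * vertex G).

(* The walk starts at x; each item of p is an edge followed by the vertex it
   leads to. *)
Fixpoint walk x p : Prop :=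
  if p is (e, y) :: p' then ends e = [set x; y] /\ walk y p' else True.

Definition walk_edges p : set (edge G) := [set e | e \in unzip1 p].

(* A loop is a cycle of length 1 and two parallel edges form one of length 2. *)
Definition is_cycle x p : Prop :=
  [/\ walk x p, p != [::], last x (unzip2 p) = x,
      uniq (unzip2 p) & uniq (unzip1 p)].

Definition finitely_separable : Prop :=
  forall u v, u <> v -> exists S : set (edge G), finite_set S /\
    forall p, walk u p -> last u (unzip2 p) = v ->
      walk_edges p `&` S !=set0.

Definition incident_vertices X : set (vertex G) :=
  \bigcup_(e in X) ends e.

Definition Tutte_separation (l : int) X Y : Prop :=
  [/\ partition2 X Y, (l%:E <= ecard X)%E, (l%:E <= ecard Y)%E &
      (ecard (incident_vertices X `&` incident_vertices Y) <= l%:E)%E].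

Definition Tutte_connected (k : int) : Prop :=
  forall l : int, (l < k)%R -> ~ exists X Y, Tutte_separation l X Y.

Definition acyclic A : Prop :=
  ~ exists x p, is_cycle x p /\ walk_edges p `<=` A.

End Graphs.

Record matroid (E : choiceType) := Matroid {
  indep : set (set E);
  indep0 : indep set0;
  indep_sub : forall I J, indep J -> I `<=` J -> indep I;
  indep_aug : forall I I', indep I -> ~ maximal indep I -> maximal indep I' ->
    exists x, (I' `\` I) x /\ indep (I `|` [set x]);
  indep_max : forall I X, I `<=` X -> indep I ->
    exists B, maximal [set J | [/\ indep J, I `<=` J & J `<=` X]] B }.

Section Matroids.
Variables (E : choiceType) (M : matroid E).
Implicit Types X Y B F : set E.

Definition base B : Prop := maximal (indep M) B.

(* The bases of the restriction of M to X. *)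
Definition base_of X B : Prop := maximal [set J | indep M J /\ J `<=` X] B.

(* The value is independent of the choice of B, B' and F; the default value of
   xget is never used, as such sets always exist. *)
Definition kappa X : \bar int :=
  xget +oo%E [set c | exists B B' F,
    [/\ base_of X B, base_of (~` X) B', F `<=` B `|` B',
        base ((B `|` B') `\` F) & c = ecard F]].

Definition separation (l : int) X Y : Prop :=
  [/\ partition2 X Y, (kappa X <= (l - 1)%:E)%E,
      (l%:E <= ecard X)%E & (l%:E <= ecard Y)%E].

Definition connected_matroid (k : int) : Prop :=
  forall l : int, (l < k)%R -> ~ exists X Y, separation l X Y.

End Matroids.

Section FiniteCycleMatroid.
Variable G : graph.
Implicit Types (x y u v : vertex G) (e : edge G) (A I J X : set (edge G)).
Implicit Types p q : seq (edge G * vertex G).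

Definition linked A u v : Prop :=
  exists p, [/\ walk u p, last u (unzip2 p) = v & walk_edges p `<=` A].

Lemma walk_cat x p q :
  walk x (p ++ q) <-> walk x p /\ walk (last x (unzip2 p)) q.
Proof.
elim: p x => [|[e y] p IH] x /=; first by split=> [|[]].
by rewrite IH; split=> [[? []]|[[]]].
Qed.

Lemma set2C u v : [set u; v] = [set v; u].
Proof. by rewrite setUC. Qed.

Lemma set2_inj u v x y : [set u; v] = [set x; y] ->
  (u = x /\ v = y) \/ (u = y /\ v = x).
Proof.
move=> h.
have hu : [set x; y] u by rewrite -h; left.
have hv : [set x; y] v by rewrite -h; right.
have hx : [set u; v] x by rewrite h; left.
have hy : [set u; v] y by rewrite h; right.
by case: hu hv hx hy => /= ? [] /= ? [] /= ? [] /= ?; subst; tauto.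
Qed.

Lemma linked_refl A u : linked A u u.
Proof. by exists [::]; split=> // e. Qed.

Lemma linked_trans A v u w : linked A u v -> linked A v w -> linked A u w.
Proof.
move=> [p [wp lp pA]] [q [wq lq qA]]; exists (p ++ q); split.
- by rewrite walk_cat lp.
- by rewrite /unzip2 map_cat last_cat -!/(unzip2 _) lp.
move=> e; rewrite /walk_edges /= /unzip1 map_cat mem_cat => /orP[]; [exact: pA|exact: qA].
Qed.

Lemma linked_edge A e u v : A e -> ends e = [set u; v] -> linked A u v.
Proof.
move=> Ae he; exists [:: (e, v)]; split=> // f.
by rewrite /walk_edges /= inE => /eqP ->.
Qed.

Lemma linked_sym A u v : linked A u v -> linked A v u.
Proof.
move=> [p [wp <- pA]]; elim: p u wp pA => [|[e y] p IH] u /=.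
  by move=> _ _; exact: linked_refl.
move=> [he wp] pA; apply: (@linked_trans _ y).
  by apply: IH => // f hf; apply: pA; rewrite /walk_edges /= inE; apply/orP; right.
apply: (@linked_edge _ e); last by rewrite he set2C.
by apply: pA; rewrite /walk_edges /= inE eqxx.
Qed.

Lemma linked_base A B u v :
  (forall e x y, A e -> ends e = [set x; y] -> linked B x y) ->
  linked A u v -> linked B u v.
Proof.
move=> AB [p [wp <- pA]]; elim: p u wp pA => [|[e y] p IH] u /=.
  by move=> _ _; exact: linked_refl.
move=> [he wp] pA; apply: (@linked_trans _ y).
  by apply: AB he; apply: pA; rewrite /walk_edges /= inE eqxx.
by apply: IH => // f hf; apply: pA; rewrite /walk_edges /= inE; apply/orP; right.
Qed.

Lemma linked_path A u v : linked A u v ->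
  exists p, [/\ walk u p, last u (unzip2 p) = v, walk_edges p `<=` A &
                uniq (u :: unzip2 p)].
Proof.
move=> [p [wp lp pA]]; elim: p u wp lp pA => [|[e y] p IH] u /=.
  by move=> _ <- _; exists [::]; split=> // e.
move=> [he wp] lp pA.
have [|q [wq lq qA uq]] := IH y wp lp.
  by move=> f hf; apply: pA; rewrite /walk_edges /= inE; apply/orP; right.
have [uin|unin] := boolP (u \in y :: unzip2 q); last first.
  exists ((e, y) :: q); split=> //=.
    move=> f; rewrite /walk_edges /= inE => /orP[/eqP ->|]; last exact: qA.
    by apply: pA; rewrite /walk_edges /= inE eqxx.
  by rewrite unin; move: uq => /= ->.
move: uin; rewrite inE => /orP[/eqP ->|uin]; first by exists q.
pose i := index u (unzip2 q).
have iq : (i < size q)%N by move: uin; rewrite -index_mem size_map.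
have eq2 : unzip2 q = unzip2 (take i.+1 q) ++ unzip2 (drop i.+1 q).
  by rewrite /unzip2 -map_cat cat_take_drop.
have lu : last y (unzip2 (take i.+1 q)) = u.
  rewrite /unzip2 map_take (take_nth u) ?size_map// last_rcons.
  exact: nth_index.
exists (drop i.+1 q); split.
- by move: wq; rewrite -{1}(cat_take_drop i.+1 q) walk_cat lu => -[].
- by rewrite -lq eq2 last_cat lu.
- by move=> f fq; apply: qA; move: fq => /mapP[z zq ->]; apply/map_f/(mem_drop zq).
move: uq; rewrite cons_uniq eq2 => /andP[_]; rewrite cat_uniq /= => /and3P[_ /hasPn h ->].
rewrite andbT; apply/negP => /h /negP; apply.
rewrite -lu; case: (take _ _) (size_takel iq) => [//|a t] _ /=.
exact: mem_last.
Qed.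

Lemma walk_ends x p e z :
  walk x p -> e \in unzip1 p -> ends e z -> z \in x :: unzip2 p.
Proof.
elim: p x => [//|[f y] p IH] x /= [hf wp]; rewrite inE => /orP[/eqP ->|ep].
  by rewrite hf => -[->|->]; rewrite !inE eqxx ?orbT.
by move=> ez; rewrite inE (IH _ wp ep ez) orbT.
Qed.

Lemma path_uniq_edges x p :
  walk x p -> uniq (x :: unzip2 p) -> uniq (unzip1 p).
Proof.
elim: p x => [//|[e y] p IH] x [he wp] /andP[xn u]; apply/andP; split.
  apply: contra xn => ep; apply: (walk_ends wp ep).
  by rewrite he; left.
exact: (IH y).
Qed.

Lemma linked_cyclic A e u v :
  ~ A e -> ends e = [set u; v] -> linked A u v -> ~ acyclic (A `|` [set e]).
Proof.
move=> nAe he /linked_path[p [wp lp pA up]]; apply; exists v, ((e, u) :: p).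
split; first split=> //=.
- by split=> //; rewrite he set2C.
- apply/andP; split; last exact: path_uniq_edges wp up.
  by apply/negP => /pA.
- move=> f; rewrite /walk_edges /= inE => /orP[/eqP ->|/pA]; [by right|by left].
Qed.

Lemma cyclic_linked A e u v :
  acyclic A -> ends e = [set u; v] -> ~ acyclic (A `|` [set e]) -> linked A u v.
Proof.
move=> acA he /contrapT[x [p [[wp pn0 lp u2 u1] pA]]].
have ep : e \in unzip1 p.
  apply/negPn/negP => enp; apply: acA; exists x, p; split=> // f fp.
  have [//|/= fe] := pA _ fp.
  by move: fp; rewrite /walk_edges /= fe (negPf enp).
move: ep => /mapP[[f z] fzp /= def_f]; subst f.
move: fzp wp lp u1 pA => /splitPr[p1 p2].
rewrite walk_cat /= /unzip2 map_cat last_cat /= -!/(unzip2 _).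
set y := last x (unzip2 p1) => -[w1 [hf w2]] l2.
rewrite /unzip1 map_cat /= uniq_catC /= mem_cat negb_or -!/(unzip1 _).
move=> /andP[/andP[n2 n1] _] pA.
have sub q : {subset unzip1 q <= unzip1 (p1 ++ (e, z) :: p2)} ->
    e \notin unzip1 q -> walk_edges q `<=` A.
  move=> h n g gq; have [//|/= ge] := pA g (h _ gq).
  by move: gq; rewrite /walk_edges /= ge (negPf n).
have l_zy : linked A z y.
  apply: (@linked_trans _ x).
    exists p2; split=> //; apply: sub => // g.
    by rewrite /unzip1 map_cat mem_cat /= inE => ->; rewrite !orbT.
  exists p1; split=> //; apply: sub => // g.
  by rewrite /unzip1 map_cat mem_cat => ->.
have [[-> ->]|[-> ->]] : (u = y /\ v = z) \/ (u = z /\ v = y).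
  by apply: set2_inj; rewrite -he.
  exact: linked_sym.
exact: l_zy.
Qed.

Lemma acyclic0 : acyclic (set0 : set (edge G)).
Proof.
move=> [x [[|[e y] p] [[//]]]] _ _ _ _ _ /(_ e); apply.
by rewrite /walk_edges /= inE eqxx.
Qed.

Lemma acyclic_sub I J : acyclic J -> I `<=` J -> acyclic I.
Proof.
move=> acJ IJ [x [p [cp pI]]]; apply: acJ; exists x, p; split=> //.
exact: subset_trans IJ.
Qed.

Lemma acyclic_aug I I' :
  acyclic I -> ~ maximal (@acyclic G) I -> maximal (@acyclic G) I' ->
  exists e, (I' `\` I) e /\ acyclic (I `|` [set e]).
Proof.
move=> acI nmaxI [acI' maxI']; apply: contrapT => noaug.
have spanI' e x y : I' e -> ends e = [set x; y] -> linked I x y.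
  move=> I'e he; have [Ie|nIe] := pselect (I e); first exact: linked_edge he.
  apply: (cyclic_linked acI he) => aug; apply: noaug; by exists e.
have spanE e x y : ends e = [set x; y] -> linked I x y.
  move=> he; have [I'e|nI'e] := pselect (I' e); first exact: spanI' he.
  apply: (linked_base spanI'); apply: (cyclic_linked acI' he) => aug.
  apply: nI'e; rewrite -(maxI' _ aug); last by move=> ?; left.
  by right.
apply: nmaxI; split=> // B acB IB; apply/seteqP; split=> // e Be.
apply: contrapT => nIe; have [x [y he]] := ends_pair e.
apply: (linked_cyclic nIe he (spanE _ _ _ he)).
by apply: acyclic_sub acB _ => f [/IB//|->].
Qed.

Lemma acyclic_max I X : I `<=` X -> acyclic I ->
  exists B, maximal [set J | [/\ acyclic J, I `<=` J & J `<=` X]] B.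
Proof.
move=> IX acI.
pose P : set (set (edge G)) := [set J | acyclic (I `|` J) /\ J `<=` X].
have [|B [[acB BX] maxB]] := @Zorn_bigcup _ P.
  move=> F FP totF; split; last by move=> e [J /FP[_ JX] /JX].
  move=> [x [p [cp pU]]].
  have [J [IJ pJ]] : exists J, (F J \/ J = set0) /\ walk_edges p `<=` I `|` J.
    move: pU; rewrite /walk_edges; elim: (unzip1 p) => [|e s IH] sU.
      by exists set0; split; [right|].
    have [|J [FJ sJ]] := IH.
      by move=> f fs; apply: sU; rewrite /= inE; apply/orP; right.
    have [Ie|[K FK Ke]] : (I `|` \bigcup_(J in F) J) e.
    - by apply: sU; rewrite /= inE eqxx.
    - exists J; split=> // f; rewrite /= inE => /orP[/eqP ->|/sJ//]; by left.
    have [JK|KJ] : J `<=` K \/ K `<=` J.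
      by case: FJ => [FJ|->]; [exact: totF|left].
    - exists K; split; first by left.
      move=> f; rewrite /= inE => /orP[/eqP ->|/sJ[|/JK]]; by [right|left].
    exists J; split=> // f; rewrite /= inE => /orP[/eqP ->|/sJ//].
    by right; exact: KJ.
  case: IJ => [/FP[acJ _]|J0]; first by apply: acJ; exists x, p.
  by apply: acI; exists x, p; split=> // e /pJ; rewrite J0 setU0.
exists (I `|` B); split.
  by split=> //=; rewrite subUset.
move=> J [acJ IJ JX] BJ; apply/seteqP; split=> //.
apply: contrapT => nJB; apply: (maxB J).
  split; first by move=> e Be; apply: BJ; right.
  by move=> JB; apply: nJB => e /JB; right.
by split=> //; rewrite (setUidr IJ).
Qed.

Definition finite_cycle_matroid : matroid (edge G) :=
  Matroid acyclic0 acyclic_sub acyclic_aug acyclic_max.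

End FiniteCycleMatroid.

(* Main.v *)
Require Import Defs.
From mathcomp Require Import all_boot all_order all_algebra.
From mathcomp Require Import finmap zify.
From mathcomp Require Import boolp classical_sets cardinality.
From mathcomp Require Import constructive_ereal.

Set Implicit Arguments.
Unset Strict Implicit.
Unset Printing Implicit Defensive.

Import Order.TTheory.

Local Open Scope classical_set_scope.

(* Any kappa_M(X) can be read off from any base T of M inside B + B', where B and
   B' are bases of the two sides X and Y: it is the size of (B + B') minus T.  So
   T may be chosen to contain any prescribed acyclic subset of B + B'.

   If X and Y share n > 0 vertices and G is connected, take T containing B.  A set
   of m > 0 edges of B' outside T yields m + 1 vertices of Y that are pairwise
   not linked in T - X, while each is linked in T - X to a vertex shared by X and
   Y; hence kappa(X) <= n - 1.

   Conversely, suppose that X and Y have at least l edges each and that there is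
   no m-Tutte-separation with m <= l.  Then every cycle has more than l edges and
   every vertex has degree greater than l.
   - If X is acyclic, take T containing B'.  There is no bridge, so X is finite
     when kappa(X) is finite.  The x edges of X in T meet x + 1 components of Y
     (if x > 0), each of which sends out at least l + 1 ends of edges of X, so
     (x + 1)(l + 1) <= 2|X|, which forces kappa(X) = |X| - x >= l.
   - If both sides contain a cycle, let C be the component of X of such a cycle
     and K the component of E - C of a cycle of Y.  Both K and its complement have
     at least l edges, so they share l + 1 vertices.  These are linked to each
     other both inside C and outside C, so a base containing B & C misses at
     least l edges of B + B'. *)

(** * Lower bounds on cardinalities, for finite and infinite sets alike *)

Section AtLeast.
Implicit Types T U : choiceType.

(** A duplicate-free list as witness lets counting ignore whether [A] is finite; [atleast_ecard] and
    [ecard_le] translate to [ecard]. *)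
Definition atleast T (n : nat) (A : set T) : Prop :=
  exists s : seq T, [/\ uniq s, size s = n & forall x, x \in s -> A x].

Lemma atleast_sub T n (A B : set T) : A `<=` B -> atleast n A -> atleast n B.
Proof. by move=> AB [s [us ss sA]]; exists s; split=> // x /sA /AB. Qed.

Lemma atleast_le T m n (A : set T) : (m <= n)%N -> atleast n A -> atleast m A.
Proof.
move=> mn [s [us ss sA]]; exists (take m s); split.
- exact: take_uniq.
- by rewrite size_take_min ss; apply/minn_idPl.
- by move=> x /mem_take /sA.
Qed.

Lemma atleast1 T (A : set T) x : A x -> atleast 1 A.
Proof. by move=> Ax; exists [:: x]; split=> // y; rewrite inE => /eqP ->. Qed.

Lemma atleast_nonempty T n (A : set T) : atleast n.+1 A -> A !=set0.
Proof. by move=> [[|x s] [//_ _ sA]]; exists x; apply: sA; rewrite mem_head. Qed.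

Lemma atleast_add T n (A : set T) x :
  A x -> atleast n (A `\` [set x]) -> atleast n.+1 A.
Proof.
move=> Ax [s [us ss sA]]; exists (x :: s); split=> //=; last 1 first.
- by move=> y; rewrite inE => /orP[/eqP ->//|/sA[]].
- by rewrite us andbT; apply/negP => /sA[_ /=]; apply.
- by rewrite ss.
Qed.

Lemma atleast_del T n (A : set T) x :
  atleast n.+1 A -> atleast n (A `\` [set x]).
Proof.
move=> [s [us ss sA]]; apply: (@atleast_le _ _ (size (rem x s))).
  have [xs|xs] := boolP (x \in s); first by rewrite size_rem // ss.
  by rewrite rem_id // ss.
exists (rem x s); split=> //; first exact: rem_uniq.
move=> y; rewrite mem_rem_uniq // inE => /andP[/= /eqP yx /sA].
by split.
Qed.

Lemma atleast_size T n (s : seq T) : atleast n [set` s] -> (n <= size s)%N.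
Proof. by move=> [t [ut <- ts]]; exact: uniq_leq_size. Qed.

Lemma not_atleast T n (A : set T) : ~ atleast n A ->
  exists s, [/\ uniq s, (size s < n)%N & A = [set` s]].
Proof.
elim: n A => [|n IH] A nA; first by case: nA; exists [::].
have [[x Ax]|A0] := pselect (A !=set0); last first.
  by exists [::]; split=> //; apply/seteqP; split=> // y Ay; case: A0; exists y.
have [|s [us ss As]] := IH (A `\` [set x]).
  by move=> h; apply: nA; exact: atleast_add h.
have xs : x \notin s.
  apply/negP => xs; have : (A `\` [set x]) x by rewrite As.
  by case=> _ /=; apply.
exists (x :: s); split=> //=; first by rewrite xs.
apply/seteqP; split=> y.
  move=> Ay; rewrite /= inE; have [//|yx] := eqVneq y x; rewrite /=.
  have : (A `\` [set x]) y by split=> //; apply/eqP.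
  by rewrite As.
rewrite /= inE => /orP[/eqP ->//|ys].
have : (A `\` [set x]) y by rewrite As.
by case.
Qed.

(** Partners are picked one at a time, so [r] need not be a function. Since distinct elements of [A]
    have no common partner, removing the chosen [y] from [B] harms no other element. *)
Lemma atleast_rel T U n (A : set T) (B : set U) (r : T -> U -> Prop) :
  (forall x, A x -> exists2 y, B y & r x y) ->
  (forall x x' y, A x -> A x' -> r x y -> r x' y -> x = x') ->
  atleast n A -> atleast n B.
Proof.
elim: n A B => [|n IH] A B rB rI; first by exists [::].
move=> An; have [x Ax] := atleast_nonempty An; have [y By rxy] := rB x Ax.
apply: (@atleast_add _ _ _ y) => //.
apply: IH (atleast_del x An) => [z [Az zx]|z z' t [Az _] [Az' _]]; last exact: rI.
have [t Bt rt] := rB z Az; exists t => //; split=> // /= ty.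
by apply: zx => /=; apply: (rI _ _ y) => //; rewrite -ty.
Qed.

Lemma atleast_bigU T U n (s : seq T) (Q : T -> set U) :
  uniq s -> (forall x, x \in s -> atleast n (Q x)) ->
  (forall x x' y, x \in s -> x' \in s -> Q x y -> Q x' y -> x = x') ->
  atleast (size s * n) [set y | exists2 x, x \in s & Q x y].
Proof.
elim: s => [|x s IH] /=; first by exists [::].
move=> /andP[xs us] Qn QI.
have [||t [ut st tQ]] := IH us.
- by move=> z zs; apply: Qn; rewrite inE zs orbT.
- by move=> z z' y zs z's; apply: QI; rewrite inE ?zs ?z's orbT.
have [t' [ut' st' t'Q]] := Qn x (mem_head _ _).
exists (t' ++ t); split.
- rewrite cat_uniq ut ut' andbT /=; apply/hasPn => y /tQ[z zs Qzy].
  apply/negP => /t'Q Qxy; move: xs; rewrite (QI x z y) ?mem_head ?zs//.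
  by rewrite inE zs orbT.
- by rewrite size_cat st st' mulSn.
- move=> y; rewrite mem_cat => /orP[/t'Q|/tQ[z zs]] Qy.
    by exists x; rewrite ?mem_head.
  by exists z; rewrite // inE zs orbT.
Qed.

Lemma atleast_setD T n m (A B : set T) :
  atleast (n + m) A -> ~ atleast m.+1 B -> atleast n (A `\` B).
Proof.
move=> [s [us ss sA]] nB; have [t [ut st ->]] := not_atleast nB.
have fs : (size (filter (mem t) s) <= size t)%N.
  by apply: uniq_leq_size; [exact: filter_uniq|move=> x; rewrite mem_filter => /andP[]].
apply: (@atleast_le _ _ (size (filter (predC (mem t)) s))).
  have := count_predC (mem t) s; rewrite -!size_filter ss; lia.
exists (filter (predC (mem t)) s); split=> //; first exact: filter_uniq.
by move=> x; rewrite mem_filter => /andP[/= /negP xt /sA].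
Qed.

Lemma atleast_ecard T n (A : set T) :
  ((n%:Z)%:E <= ecard A)%E <-> atleast n A.
Proof.
rewrite /ecard; case: pselect => fA; last first.
  split=> [_|_]; last by rewrite leey.
  apply: contrapT => /not_atleast[s [_ _ As]]; apply: fA.
  by rewrite As; exact: finite_seq.
rewrite lee_fin lez_nat; split=> [nA|[s [us <- sA]]].
  apply: atleast_le nA _; exists (fset_set A); split=> //.
  by move=> x; rewrite in_fset_set // inE.
apply: (uniq_leq_size us) => // x /sA Ax.
by rewrite in_fset_set // inE.
Qed.

Lemma ecard_le T n (A : set T) :
  (ecard A <= (n%:Z)%:E)%E <-> ~ atleast n.+1 A.
Proof.
rewrite -atleast_ecard /ecard; case: pselect => fA; last first.
  by rewrite leey leye_eq; split=> // h; case: h.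
by rewrite !lee_fin !lez_nat leqNgt; split=> /negP.
Qed.

Lemma ecard_ge0 T (A : set T) : (0%:E <= ecard A)%E.
Proof. by apply/(atleast_ecard 0); exists [::]. Qed.

End AtLeast.

(** * Base exchange and the evaluation of [kappa] *)

Section Bases.
Variables (E : choiceType) (M : matroid E).
Implicit Types (A B F X : set E) (n : nat).

(** Augmenting [B] minus [x] from [B'] yields [y]. If the result were not a base, augmenting it from
    [B] could only restore [x], and [B] plus [y] would be independent. *)
Lemma base_exchange B B' x : base M B -> base M B' -> (B `\` B') x ->
  exists2 y, (B' `\` B) y & base M ((B `\` [set x]) `|` [set y]).
Proof.
move=> [iB mB] bB' [Bx B'x].
have BxB : B `\` [set x] `<=` B by move=> z [].
have iBx : indep M (B `\` [set x]) := indep_sub iB BxB.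
have nBx : ~ maximal (indep M) (B `\` [set x]).
  move=> [_ /(_ _ iB BxB) Bdef].
  by have : (B `\` [set x]) x by [rewrite -Bdef]; case=> _; apply.
have [y [[B'y nBxy] iBy]] := indep_aug iBx nBx bB'.
have By : ~ B y.
  by move=> By; apply: nBxy; split=> // yx; apply: B'x; rewrite -yx.
exists y => //; apply: contrapT => nb.
have [z [[Bz nz] iz]] := indep_aug iBy nb (conj iB mB).
have zx : z = x.
  by apply: contrapT => zx; apply: nz; left; split.
apply: By; rewrite -(mB _ iz); first by left; right.
move=> t Bt; have [->|tx] := pselect (t = x); first by right.
by left; left; split.
Qed.

Lemma atleast_base_diff n B B' : base M B -> base M B' ->
  atleast n (B `\` B') -> atleast n (B' `\` B).
Proof.
move=> bB bB'; elim: n B bB => [|n IH] B bB; first by exists [::].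
move=> Bn; have [x BB'x] := atleast_nonempty Bn.
have [y [B'y By] bC] := base_exchange bB bB' BB'x.
apply: (@atleast_add _ _ _ y) => //.
have Cn : atleast n (((B `\` [set x]) `|` [set y]) `\` B').
  apply: atleast_sub (atleast_del x Bn) => z [[Bz B'z] zx].
  by split=> //; left; split.
apply: atleast_sub (IH _ bC Cn) => z [B'z Cz]; split; last first.
  by move=> /= zy; apply: Cz; right.
split=> // Bz; apply: Cz; left; split=> //= zx.
by case: BB'x => _; rewrite -zx.
Qed.

(** Elements of [F] inside [F'] are kept. Those outside [F'] lie in the second base but not in the
    first, so [atleast_base_diff] replaces them by as many elements of [F'] outside [F]. *)
Lemma atleast_base_compl n A F F' : F `<=` A -> F' `<=` A ->
  base M (A `\` F) -> base M (A `\` F') -> atleast n F -> atleast n F'.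
Proof.
move=> FA F'A bF bF' [s [us <- sF]].
pose inF' : pred E := fun x => `[< F' x >].
have [|t [ut st tF]] := @atleast_base_diff (size (filter (predC inF') s)) _ _ bF' bF.
  exists (filter (predC inF') s); split=> //; first exact: filter_uniq.
  move=> x; rewrite mem_filter => /andP[/= /asboolPn F'x xs].
  split; first by split=> //; apply/FA/sF.
  by case=> _; apply; exact: sF.
have {}tF x : x \in t -> F' x /\ ~ F x.
  move=> /tF[[Ax nFx] h]; split=> //.
  by apply: contrapT => nF'x; apply: h; split.
exists (filter inF' s ++ t); split.
- rewrite cat_uniq ut filter_uniq // andbT; apply/hasPn => x /tF[_ nFx].
  by apply/negP; rewrite mem_filter => /andP[_ /sF].
- by rewrite size_cat st !size_filter; exact: count_predC.
- move=> x; rewrite mem_cat mem_filter => /orP[/andP[/asboolP//]|/tF[]//].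
Qed.

(** A finite bound excludes the default value [+oo] of [xget]. *)
Lemma kappa_le_witness X (c : \bar int) : (c < +oo)%E -> (kappa M X <= c)%E ->
  exists B B' F, [/\ base_of M X B, base_of M (~` X) B', F `<=` B `|` B',
    base M ((B `|` B') `\` F) & (ecard F <= c)%E].
Proof.
rewrite /kappa; case: xgetP => [_ -> [B [B' [F [bB bB' FB bF ->]]]] _ Fc|_].
  by exists B, B', F.
by rewrite leye_eq => /[swap] /eqP ->; rewrite ltxx.
Qed.

(** The explicit witness keeps [xget] from its default; the value it picks is then covered by the
    bound on all witnesses. *)
Lemma kappa_le X B B' F (c : \bar int) :
  base_of M X B -> base_of M (~` X) B' -> F `<=` B `|` B' ->
  base M ((B `|` B') `\` F) ->
  (forall C C' F', base_of M X C -> base_of M (~` X) C' -> F' `<=` C `|` C' ->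
     base M ((C `|` C') `\` F') -> (ecard F' <= c)%E) ->
  (kappa M X <= c)%E.
Proof.
move=> bB bB' FB bF le; rewrite /kappa; case: xgetP => [_ _ [C [C' [F' [bC bC' FC bF' ->]]]]|].
  exact: le bF'.
by move=> /(_ (ecard F)); case; exists B, B', F.
Qed.

End Bases.

(** * Linked vertices, forests and the effect of adding edges *)

Section Linked.
Variable G : graph.
Implicit Types (x y u v w r : vertex G) (e f : edge G) (A B X Y : set (edge G)).

Lemma linked_sub A B u v : A `<=` B -> linked A u v -> linked B u v.
Proof. by move=> AB [p [wp lp pA]]; exists p; split=> // e /pA /AB. Qed.

Lemma linked_ends A e u v : A e -> ends e u -> ends e v -> linked A u v.
Proof.
move=> Ae eu ev; have [x [y he]] := ends_pair e.
have xy := linked_edge Ae he; move: eu ev; rewrite he.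
by case=> ->; case=> ->; try exact: linked_refl => //; [|exact: linked_sym].
Qed.

Lemma linked_setU1 A e u v x y : ends e = [set u; v] ->
  linked (A `|` [set e]) x y ->
  [\/ linked A x y, linked A x u /\ linked A v y | linked A x v /\ linked A u y].
Proof.
move=> he [p [wp <- pA]]; elim: p x wp pA => [|[f z] p IH] x /=.
  by move=> _ _; constructor 1; exact: linked_refl.
move=> [hf wp] pA; have pA' : walk_edges p `<=` A `|` [set e].
  by move=> g gp; apply: pA; rewrite /walk_edges /= inE; apply/orP; right.
have [Af|fe] : (A `|` [set e]) f by apply: pA; rewrite /walk_edges /= inE eqxx.
  have xz := linked_edge Af hf.
  by case: (IH z wp pA') => [h|[h ?]|[h ?]]; [constructor 1|constructor 2|constructor 3];
    try split=> //; exact: linked_trans xz h.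
have : (x = u /\ z = v) \/ (x = v /\ z = u).
  by apply: set2_inj; rewrite -hf -he fe.
have h := IH z wp pA'; case=> -[xz zz]; subst x z; case: h => [h|[h1 h2]|[h1 h2]].
- by constructor 2; split=> //; exact: linked_refl.
- by constructor 2; split=> //; exact: linked_refl.
- by constructor 1.
- by constructor 3; split=> //; exact: linked_refl.
- by constructor 1.
- by constructor 3; split=> //; exact: linked_refl.
Qed.

Definition unlinked A (s : seq (vertex G)) : Prop :=
  forall x y, x \in s -> y \in s -> linked A x y -> x = y.

(* Adding an edge merges at most two classes, so it costs at most one element
   of a set of pairwise unlinked vertices. *)
Lemma unlinked_setU1 A e s n : uniq s -> size s = n.+1 -> unlinked A s ->
  exists t, [/\ uniq t, size t = n, {subset t <= s} & unlinked (A `|` [set e]) t].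
Proof.
move=> us ss unl; have [u [v he]] := ends_pair e.
have rem_case r : (forall x y, x \in s -> y \in s -> x != r -> y != r ->
      linked (A `|` [set e]) x y -> x = y) -> r \in s ->
    exists t, [/\ uniq t, size t = n, {subset t <= s} & unlinked (A `|` [set e]) t].
  move=> h rs; exists (rem r s); split; first exact: rem_uniq.
  - by rewrite size_rem // ss.
  - exact: mem_rem.
  - by move=> x y; rewrite !mem_rem_uniq // !inE => /andP[xr xs] /andP[yr ys]; apply: h.
have [[r rs ru]|nu] := pselect (exists2 r, r \in s & linked A r u).
  apply: (rem_case r) => // x y xs ys xr yr.
  case/(linked_setU1 he) => [|[xu _]|[_ uy]]; first exact: unl.
  - by move/eqP: xr; case; apply: unl => //; apply: linked_trans xu (linked_sym ru).
  - by move/eqP: yr; case; apply: unl => //; apply: linked_sym; apply: linked_trans ru uy.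
(* No vertex of [s] is linked to [u], so the new edge merges no two of them, and any one may be
   dropped to reach size [n]. *)
case: s us ss unl nu rem_case => // r s us ss unl nu rem_case.
apply: (rem_case r); last exact: mem_head.
move=> x y xs ys _ _ /(linked_setU1 he)[|[xu _]|[_ uy]]; first exact: unl.
- by case: nu; exists x.
- by case: nu; exists y => //; exact: linked_sym.
Qed.

(** By [unlinked_setU1], adding fewer than [n] edges one at a time would leave two vertices of [s]
    unlinked. *)
Lemma unlinked_atleast A F s n : uniq s -> size s = n.+1 -> unlinked A s ->
  (forall x y, x \in s -> y \in s -> linked (A `|` F) x y) -> atleast n F.
Proof.
move=> us ss unl lF; apply: contrapT => /not_atleast[t [ut st Ft]].
rewrite {F}Ft in lF.
elim: t A n s us ss unl lF st {ut} => [|e t IH] A n s us ss unl lF st.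
  case: n ss st => // n; case: s us unl lF => [//|x [//|y s]] /= /andP[xs _] unl lF _ _.
  have xy : x = y.
    apply: unl; rewrite ?inE ?eqxx ?orbT //.
    have := lF x y; rewrite !inE !eqxx orbT => /(_ isT isT).
    by apply: linked_sub => z [].
  by move: xs; rewrite xy mem_head.
have [s' [us' ss' s's unl']] := unlinked_setU1 e us ss unl.
case: n ss ss' st => [//|n] ss ss' st.
apply: (IH (A `|` [set e]) n s') => //.
move=> x y /s's xs /s's ys; apply: linked_sub (lF x y xs ys) => z [Az|].
  by left; left.
by rewrite /= inE => /orP[/eqP ->|zt]; [left; right|right].
Qed.

Lemma acyclic_unlinked A e u v : ~ A e -> ends e = [set u; v] ->
  acyclic (A `|` [set e]) -> ~ linked A u v.
Proof. by move=> Ae he ac /(linked_cyclic Ae he). Qed.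

(** After contracting the classes of [A], the list [t] is a forest with [n + 1] edges, so it covers
    at least [n + 2] classes. The induction contracts the first edge [e] too; undoing this splits a
    class and gains a vertex. *)
Lemma acyclic_atleast A (t : seq (edge G)) n : uniq t -> size t = n.+1 ->
  (forall e, e \in t -> ~ A e) -> acyclic (A `|` [set` t]) ->
  exists s, [/\ uniq s, size s = n.+2, unlinked A s &
    forall v, v \in s -> incident_vertices [set` t] v].
Proof.
elim: n A t => [|n IH] A [//|e t] /= /andP[et ut] [st] At ac.
  case: t st et ut At ac => // _ _ _ At ac.
  have Ae : ~ A e by apply: At; rewrite mem_head.
  have [u [v he]] := ends_pair e.
  have nuv : ~ linked A u v.
    apply: (acyclic_unlinked Ae he); apply: acyclic_sub ac _ => f [|->]; [by left|].
    by right; rewrite /= mem_head.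
  exists [:: u; v]; split=> //=.
  - rewrite inE andbT; apply/eqP => uv; apply: nuv; rewrite uv; exact: linked_refl.
  - move=> x y; rewrite !inE => /orP[]/eqP -> /orP[]/eqP -> // h; case: nuv => //.
    exact: linked_sym.
  - move=> w; rewrite !inE => wuv; exists e; rewrite /= ?mem_head // he.
    by case/orP: wuv => /eqP ->; [left|right].
have Ae : ~ A e by apply: At; rewrite mem_head.
have [u [v he]] := ends_pair e.
have nuv : ~ linked A u v.
  apply: (acyclic_unlinked Ae he); apply: acyclic_sub ac _ => f [|->]; [by left|].
  by right; rewrite /= mem_head.
have [||s [us ss unl sV]] := IH (A `|` [set e]) t ut st.
- move=> f ft [Af|fe]; first by apply: (At f) Af; rewrite inE ft orbT.
  by move: et; rewrite -fe ft.
- apply: acyclic_sub ac _ => f [[|->]|/= ft]; [by left|right|right] => /=.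
    exact: mem_head.
  by rewrite inE ft orbT.
have eV w : ends e w -> incident_vertices [set` e :: t] w.
  by move=> ew; exists e; rewrite /= ?mem_head.
have sV' w : w \in s -> incident_vertices [set` e :: t] w.
  by move=> /sV[f ft fw]; exists f => //=; rewrite inE; apply/orP; right.
have unlA : unlinked A s.
  by move=> x y xs ys h; apply: unl => //; apply: linked_sub h => f; left.
have uv_e : linked (A `|` [set e]) u v by apply: linked_edge he; right.
(* At most one vertex of s is linked to an end of e, and then it is linked in A
   to at most one of the two ends, so the other end can be added to s. *)
have [z ez nz] : exists2 z, ends e z & forall w, w \in s -> ~ linked A w z.
  have [[r rs ru]|nu] := pselect (exists2 r, r \in s & linked A r u); last first.
    by exists u; [rewrite he; left|move=> w ws wu; apply: nu; exists w].
  exists v; first by rewrite he; right.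
  move=> w ws wv; have rw : r = w.
    apply: unl => //; apply: (@linked_trans _ _ u).
      by apply: linked_sub ru => f; left.
    apply: (linked_trans uv_e); apply: linked_sym.
    by apply: linked_sub wv => f; left.
  by apply: nuv; apply: linked_trans (linked_sym ru) _; rewrite rw.
exists (z :: s); split=> /=.
- by rewrite us andbT; apply/negP => zs; apply: (nz z zs); exact: linked_refl.
- by rewrite ss.
- move=> x y; rewrite !inE => /orP[/eqP ->|xs] /orP[/eqP ->|ys] // h.
  + by case: (nz y ys); exact: linked_sym.
  + by case: (nz x xs).
  + exact: unlA.
- by move=> w; rewrite inE => /orP[/eqP ->|]; [exact: eV|exact: sV'].
Qed.

(** If the path in [A] had a first edge [e], the rest of the path and the walk in [B] would link the
    ends of [e] without using [e], closing a cycle. *)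
Lemma acyclic_disjoint_linked A B u v : acyclic (A `|` B) -> A `&` B = set0 ->
  linked A u v -> linked B u v -> u = v.
Proof.
move=> ac AB0 /linked_path[[|[e y] p] [/= + lp pA]] => [_ _|]; first by [].
move=> [he wp] up uvB; exfalso.
have Ae : A e by apply: pA; rewrite /walk_edges /= mem_head.
have ue : uniq (e :: unzip1 p).
  by apply: (@path_uniq_edges _ u ((e, y) :: p)) => //; split.
have nBe : ~ B e.
  by move=> Be; have : (A `&` B) e by []; rewrite AB0.
apply: (@acyclic_unlinked ((A `|` B) `\` [set e]) e u y) => //.
- by move=> [_]; apply.
- apply: acyclic_sub ac _ => f [[]//|->]; by left.
apply: (@linked_trans _ _ v).
  apply: linked_sub uvB => f Bf; split; first by right.
  by move=> /= fe; apply: nBe; rewrite -fe.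
apply: linked_sym; exists p; split=> // f fp; split.
  by left; apply: pA; rewrite /walk_edges /= inE; apply/orP; right.
by move=> /= fe; move: ue; rewrite /= -fe; move: fp; rewrite /walk_edges /= => ->.
Qed.

End Linked.

(** * Bases of the finite-cycle matroid; from matroid connectivity to Tutte-connectivity *)

Section FiniteCycleMatroidBases.
Variable G : graph.
Implicit Types (x y u v w r : vertex G) (e f : edge G).
Implicit Types (A B F I X Y : set (edge G)).
Let M := finite_cycle_matroid G.

(** Taken as an edge set, so that it can be a side of a separation. *)
Definition component A x : set (edge G) :=
  [set e | A e /\ exists2 v, ends e v & linked A x v].

Definition boundary X : set (vertex G) :=
  incident_vertices X `&` incident_vertices (~` X).

Lemma component_sub A x : component A x `<=` A.
Proof. by move=> e []. Qed.

Lemma component_ends A x e v : component A x e -> ends e v -> linked A x v.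
Proof. by move=> [Ae [u eu xu]] ev; apply: linked_trans xu (linked_ends Ae eu ev). Qed.

Lemma linked_component A x v : linked A x v -> linked (component A x) x v.
Proof.
move=> [p [wp <- pA]].
have h u : linked A x u -> walk u p -> linked (component A x) u (last u (unzip2 p)).
  elim: p u pA {wp} => [|[e y] p IH] u /= pA xu; first by move=> _; exact: linked_refl.
  move=> [he wp].
  have Ae : A e by apply: pA; rewrite /walk_edges /= mem_head.
  have eu : ends e u by rewrite he; left.
  have ey : ends e y by rewrite he; right.
  apply: (@linked_trans _ _ y); last first.
    apply: IH => //; last exact: linked_trans xu (linked_ends Ae eu ey).
    by move=> f fp; apply: pA; rewrite /walk_edges /= inE; apply/orP; right.
  by apply: (linked_ends _ eu ey); split=> //; exists u.
by apply: h => //; exact: linked_refl.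
Qed.

(** Stated for bare maximality inside [X], to serve bases of [M], bases of restrictions, and the
    maximal forests in [base_extend]. *)
Lemma maximal_acyclic_linked B X e u v :
  acyclic B -> (forall J, acyclic J -> B `<=` J -> J `<=` X -> J = B) ->
  B `<=` X -> X e -> ends e u -> ends e v -> linked B u v.
Proof.
move=> acB maxB BX Xe eu ev.
have [Be|Be] := pselect (B e); first exact: linked_ends eu ev.
have [x [y he]] := ends_pair e.
have xy : linked B x y.
  apply: (cyclic_linked acB he) => ac; apply: Be.
  by rewrite -(maxB _ ac); [right|left|move=> f [/BX//|->]].
by move: eu ev; rewrite he => -[->|->] [->|->] //; try exact: linked_refl; exact: linked_sym.
Qed.

Lemma base_of_linked_ends X B e u v :
  base_of M X B -> X e -> ends e u -> ends e v -> linked B u v.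
Proof.
move=> [[acB BX] maxB]; apply: (maximal_acyclic_linked acB) => // J acJ BJ JX.
exact: maxB.
Qed.

Lemma base_of_linked X B u v : base_of M X B -> linked X u v -> linked B u v.
Proof.
move=> bB; apply: linked_base => e x y Xe he.
by apply: (base_of_linked_ends bB Xe); rewrite he; [left|right].
Qed.

Lemma base_linked T u v : base M T -> linked setT u v -> linked T u v.
Proof.
move=> [acT maxT]; apply: linked_base => e x y _ he.
apply: (@maximal_acyclic_linked _ setT e) => //.
- by move=> J acJ TJ _; exact: maxT.
- by rewrite he; left.
- by rewrite he; right.
Qed.

Lemma base_of_exists X : exists B, base_of M X B.
Proof.
have [B [[acB _ BX] maxB]] := acyclic_max (@sub0set _ X) (@acyclic0 G).
by exists B; split=> // J [acJ JX] BJ; apply: maxB => //; split=> //; exact: sub0set.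
Qed.

(** A maximal forest [T] between [I] and the union of [B] and [B'] links the ends of every edge of
    that union, and the union links the ends of every edge of [G]. So no further edge fits. *)
Lemma base_extend X B B' I : base_of M X B -> base_of M (~` X) B' ->
  I `<=` B `|` B' -> acyclic I ->
  exists T, [/\ base M T, I `<=` T & T `<=` B `|` B'].
Proof.
move=> bB bB' IB acI; have [T [[acT IT TB] maxT]] := acyclic_max IB acI.
exists T; split=> //; split=> // J acJ TJ; apply/seteqP; split=> // e Je.
apply: contrapT => Te; have [u [v he]] := ends_pair e.
have acTe : acyclic (T `|` [set e]) by apply: acyclic_sub acJ _ => f [/TJ|->].
apply: (acyclic_unlinked Te he acTe).
have BTl : forall f x y, (B `|` B') f -> ends f = [set x; y] -> linked T x y.
  move=> f x y Bf hf; apply: (@maximal_acyclic_linked _ (B `|` B') f) => //.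
  - by move=> K acK TK KB; apply: maxT => //; split=> //; exact: subset_trans TK.
  - by rewrite hf; left.
  - by rewrite hf; right.
apply: (linked_base BTl); have eu : ends e u by rewrite he; left.
have ev : ends e v by rewrite he; right.
have [Xe|Xe] := pselect (X e).
  by apply: linked_sub (base_of_linked_ends bB Xe eu ev) => f; left.
by apply: linked_sub (base_of_linked_ends bB' Xe eu ev) => f; right.
Qed.

Lemma base_compl X B B' F I : base_of M X B -> base_of M (~` X) B' ->
  F `<=` B `|` B' -> base M ((B `|` B') `\` F) ->
  I `<=` B `|` B' -> acyclic I ->
  exists F0, [/\ F0 `<=` (B `|` B') `\` I, base M ((B `|` B') `\` F0) &
    forall n, atleast n F <-> atleast n F0].
Proof.
move=> bB bB' FB bF IB acI; have [T [bT IT TB]] := base_extend bB bB' IB acI.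
exists ((B `|` B') `\` T).
have bT' : base M ((B `|` B') `\` ((B `|` B') `\` T)) by rewrite setDD (setIidr TB).
split=> //; first by move=> e [Be Te]; split=> // /IT.
have TA : (B `|` B') `\` T `<=` B `|` B' by move=> e [].
by move=> n; split; [exact: atleast_base_compl FB TA bF bT'|exact: atleast_base_compl TA FB bT' bF].
Qed.

Lemma kappa_witness X : exists B B' F, [/\ base_of M X B, base_of M (~` X) B',
  F `<=` B `|` B' & base M ((B `|` B') `\` F)].
Proof.
have [B bB] := base_of_exists X; have [B' bB'] := base_of_exists (~` X).
have [T [bT _ TB]] := base_extend bB bB' (@sub0set _ _) (@acyclic0 G).
exists B, B', ((B `|` B') `\` T); split=> //.
by rewrite setDD (setIidr TB).
Qed.

Lemma kappa_le_nat X n :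
  (forall B B' F, base_of M X B -> base_of M (~` X) B' -> F `<=` B `|` B' ->
     base M ((B `|` B') `\` F) -> ~ atleast n.+1 F) ->
  (kappa M X <= (n%:Z)%:E)%E.
Proof.
move=> h; have [B [B' [F [bB bB' FB bF]]]] := kappa_witness X.
by apply: (kappa_le bB bB' FB bF) => C C' F' bC bC' FC bF'; apply/ecard_le; exact: h bF'.
Qed.

(** Follow the walk up to its first edge in [X]: the vertex reached there is incident with both
    sides. *)
Lemma linked_exit A X u w : incident_vertices (~` X) u -> linked A u w ->
  linked (A `\` X) u w \/ exists2 s, boundary X s & linked (A `\` X) u s.
Proof.
move=> + [p [wp <- pA]]; elim: p u wp pA => [|[e y] p IH] u /=.
  by move=> *; left; exact: linked_refl.
move=> [he wp] pA uY.
have Ae : A e by apply: pA; rewrite /walk_edges /= mem_head.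
have eu : ends e u by rewrite he; left.
have ey : ends e y by rewrite he; right.
have [Xe|Xe] := pselect (X e).
  by right; exists u; [split=> //; exists e|exact: linked_refl].
have uy : linked (A `\` X) u y by apply: (linked_ends _ eu ey).
have [||h|[s Ss h]] := IH y wp.
- by move=> f fp; apply: pA; rewrite /walk_edges /= inE; apply/orP; right.
- by exists e.
- by left; exact: linked_trans uy h.
- by right; exists s => //; exact: linked_trans uy h.
Qed.

(** With [T] chosen to contain [B], all deleted edges lie in [B']. Together with the rest of [B']
    they form a forest, to which [acyclic_atleast] applies. *)
Lemma unlinked_of_compl X B B' F n : base_of M X B -> base_of M (~` X) B' ->
  F `<=` B `|` B' -> base M ((B `|` B') `\` F) -> atleast n.+1 F ->
  exists T t s, [/\ base M T, size t = n.+1, uniq s /\ size s = n.+2,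
    unlinked (T `\` X) s & forall v, v \in s -> incident_vertices ([set` t] `\` X) v].
Proof.
move=> bB bB' FB bF Fn.
have BB : B `<=` B `|` B' by move=> e; left.
have [[acB BX] _] := bB; have [[acB' B'X] _] := bB'.
have [F0 [F0B bT FF0]] := base_compl bB bB' FB bF BB acB.
have F0B' e : F0 e -> B' e by move=> /F0B[[]].
have [t [ut st tF0]] : atleast n.+1 F0 by apply/FF0.
have [||s [us ss unl sV]] := @acyclic_atleast _ (B' `\` F0) t n ut st.
- by move=> e /tF0 F0e [].
- by apply: acyclic_sub acB' _ => e [[]//|/tF0 /F0B'].
exists ((B `|` B') `\` F0), t, s; split=> //.
  move=> x y xs ys h; apply: unl => //; apply: linked_sub h => e [[[Be|B'e] F0e] Xe] //.
  by case: Xe; exact: BX.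
move=> v /sV[e et ev]; exists e => //; split=> //.
by apply: B'X; apply: F0B'; exact: tF0.
Qed.

Lemma kappa_le_boundary X n :
  (forall v, incident_vertices (~` X) v ->
     exists2 s, boundary X s & linked setT v s) ->
  ~ atleast n.+2 (boundary X) -> (kappa M X <= (n%:Z)%:E)%E.
Proof.
move=> conn nS; apply: kappa_le_nat => B B' F bB bB' FB bF.
move=> /(unlinked_of_compl bB bB' FB bF)[T [t [s [bT st [us ss] unl sV]]]].
apply: nS; have : atleast n.+2 [set` s] by exists s.
apply: (@atleast_rel _ _ _ _ _ (linked (T `\` X))); last first.
  by move=> x x' y xs x's xy x'y; apply: unl => //; apply: linked_trans xy (linked_sym x'y).
move=> v /sV[e [_ Xe] ev].
have vY : incident_vertices (~` X) v by exists e.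
have [w Sw /(base_linked bT) vw] := conn v vY.
by case: (linked_exit vY vw) => [h|[r Sr h]]; [exists w|exists r].
Qed.

(** A deleted edge would have ends that are linked in [T] but not in [T] minus [X], although a walk
    cannot enter [X] without a boundary vertex. *)
Lemma kappa_le0 X : boundary X = set0 -> (kappa M X <= 0%:E)%E.
Proof.
move=> S0; apply: (@kappa_le_nat _ 0) => B B' F bB bB' FB bF.
move=> /(unlinked_of_compl bB bB' FB bF)[T [t [s [bT st [us ss] unl sV]]]].
case: t st sV => [//|e [|//]] _ sV.
case: s us ss unl sV => [//|u [//|v [|//]]] /= /andP[uv _] _ unl sV.
have ends_s w : w \in [:: u; v] -> ends e w /\ ~ X e.
  by move=> /sV[f [+ Xf] fw]; rewrite /= inE => /eqP <-.
have [eu Xe] : ends e u /\ ~ X e by apply: ends_s; rewrite mem_head.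
have [ev _] : ends e v /\ ~ X e by apply: ends_s; rewrite !inE eqxx orbT.
have uY : incident_vertices (~` X) u by exists e.
have euv : linked setT u v by apply: linked_ends eu ev.
case: (linked_exit uY (base_linked bT euv)) => [h|[r]]; last by rewrite S0.
by move: uv; rewrite (unl u v) ?inE ?eqxx ?orbT.
Qed.

Lemma matroid_Tutte_connected (k : int) : (2 <= k)%R ->
  connected_matroid M k -> Tutte_connected G k.
Proof.
move=> k2 Mk.
(* An empty boundary would give a 1-separation, which [2 <= k] forbids. *)
have bd_neq0 X : X !=set0 -> ~` X !=set0 -> boundary X !=set0.
  move=> X0 Y0; apply: contrapT => S0; apply: (Mk 1%R); first by lia.
  exists X, (~` X); split.
  - by split=> //; [exact: setUCr|exact: setICr].
  - by apply: kappa_le0; apply/seteqP; split=> // v Sv; apply: S0; exists v.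
  - by apply/atleast_ecard; have [e Xe] := X0; apply: atleast1 Xe.
  - by apply/atleast_ecard; have [e Xe] := Y0; apply: atleast1 Xe.
(* Otherwise the component of [u] and its complement would share no vertex. *)
have conn u v : incident_vertices setT u -> incident_vertices setT v -> linked setT u v.
  move=> [e _ eu] [f _ fv]; apply: contrapT => nuv.
  have [||z [[g Cg gz] [h Ch hz]]] := bd_neq0 (component setT u).
  - by exists e; split=> //; exists u => //; exact: linked_refl.
  - by exists f => Cf; apply: nuv; exact: component_ends Cf fv.
  - apply: Ch; split=> //; exists z => //; exact: component_ends Cg gz.
move=> l lk [X [Y [[X0 Y0 XY XY0] Xl Yl Sl]]].
have YX : Y = ~` X.
  apply/seteqP; split=> e; first by move=> Ye Xe; have : (X `&` Y) e by []; rewrite XY0.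
  by move=> Xe; have : (X `|` Y) e by [rewrite XY]; case.
rewrite {}YX {Y XY XY0} in Y0 Yl Sl.
have [z Sz] := bd_neq0 X X0 Y0.
(* For [l = 0] the boundary is nonempty, and negative [l] is absurd. For [l = n + 1], at most
   [n + 1] boundary vertices give [kappa] at most [n = l - 1]. *)
case: l lk Xl Yl Sl => [[|n]|n] lk Xl Yl Sl.
- by move/ecard_le: Sl; apply; exact: (@atleast1 _ _ z).
- apply: (Mk _ lk); exists X, (~` X); split=> //.
    by split=> //; [exact: setUCr|exact: setICr].
  have -> : (n.+1%:Z - 1 = n%:Z)%R by lia.
  apply: kappa_le_boundary; last exact/ecard_le.
  move=> v [e _ ev]; exists z => //; apply: conn; first by exists e.
  by case: Sz => [[f _ fz] _]; exists f.
- by have := le_trans (ecard_ge0 _) Sl.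
Qed.

End FiniteCycleMatroidBases.

(** * Counting pairs of an edge and one of its ends *)

Section Darts.
Variable G : graph.
Implicit Types (s : seq (edge G)) (v : vertex G).

Lemma darts_bound s n :
  atleast n [set d : edge G * vertex G | d.1 \in s /\ ends d.1 d.2] ->
  (n <= (size s).*2)%N.
Proof.
move=> dn; have [t <- dt] : exists2 t : seq (edge G * vertex G), size t = (size s).*2 &
    forall e v, e \in s -> ends e v -> (e, v) \in t.
  elim: s {dn} => [|e s [t st IH]]; first by exists [::].
  have [u [v he]] := ends_pair e.
  exists [:: (e, u), (e, v) & t] => [|f w]; first by rewrite /= st doubleS.
  rewrite inE => /orP[/eqP ->|fs fw]; last by rewrite !inE IH ?orbT.
  by rewrite he => -[->|->]; rewrite !inE eqxx ?orbT.
by apply: atleast_size; apply: atleast_sub dn => -[e v] [/=]; exact: dt.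
Qed.

End Darts.

(** * Lower bounds on the deleted set when there are no small Tutte-separations *)

Section NoSmallTutteSeparation.
Variables (G : graph) (l : nat).
Implicit Types (x y u v w r : vertex G) (e f : edge G).
Implicit Types (B F P X : set (edge G)).
Let M := finite_cycle_matroid G.

Hypothesis l_gt0 : (0 < l)%N.
Hypothesis large_boundary : forall m P, (0 < m <= l)%N ->
  atleast m P -> atleast m (~` P) -> atleast m.+1 (boundary P).
Hypothesis edges_ge : atleast (l + l) [set: edge G].

Lemma atleast_setC m n P : (m + n <= l + l)%N ->
  ~ atleast n.+1 P -> atleast m (~` P).
Proof.
move=> mn nP; apply: (@atleast_sub _ _ ([set: edge G] `\` P)); first by move=> e [].
exact: atleast_setD (atleast_le mn edges_ge) nP.
Qed.

(** A cycle has as many vertices as edges, so with [m <= l] edges it would have a boundary of at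
    most [m] vertices; [edges_ge] makes its complement large enough. *)
Lemma girth x p : is_cycle x p -> (l < size p)%N.
Proof.
move=> [wp p0 lp _ ue]; rewrite ltnNge; apply/negP => pl.
have sp : size (unzip1 p) = size p by rewrite size_map.
have np : (0 < size p)%N by rewrite lt0n size_eq0.
have nP : ~ atleast (size p).+1 (walk_edges p).
  by move=> /(@atleast_size _ _ (unzip1 p)); rewrite sp ltnn.
have P : atleast (size p) (walk_edges p) by exists (unzip1 p).
have PC : atleast (size p) (~` walk_edges p) by apply: atleast_setC nP; rewrite leq_add.
have bdV : boundary (walk_edges p) `<=` [set` unzip2 p].
  move=> z [[e ep ez] _]; have := walk_ends wp ep ez; rewrite inE => /orP[/eqP ->|//].
  by rewrite /= -{1}lp; case: (p) p0 => //= a q _; exact: mem_last.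
have := large_boundary _ P PC; rewrite np pl => /(_ isT) /(atleast_sub bdV) /atleast_size.
by rewrite size_map ltnn.
Qed.

(** Let [t] list the at most [l] edges at [v]. Then [v] is not in the boundary of [t], so each edge
    of [t] contributes at most its other end: too few boundary vertices. *)
Lemma degree v : incident_vertices setT v -> atleast l.+1 [set e | ends e v].
Proof.
move=> [e0 _ e0v]; apply: contrapT => /not_atleast[t [ut tl Dt]].
have t0 : (0 < size t)%N.
  have : [set` t] e0 by rewrite -Dt.
  by case: (t).
have P : atleast (size t) [set` t] by exists t.
have nP : ~ atleast (size t).+1 [set` t] by move=> /atleast_size; rewrite ltnn.
have PC : atleast (size t) (~` [set` t]) by apply: atleast_setC nP; rewrite leq_add.
have := large_boundary _ P PC; rewrite t0 -ltnS tl => /(_ isT) bt.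
apply: nP; apply: (@atleast_rel _ _ _ _ _ (fun z e => e \in t /\ ends e z)) bt => [z|z z' e].
  by move=> [[e et ez] _]; exists e.
move=> [_ [f ft fz]] [_ [f' ft' fz']] [et ez] [_ ez'].
have zv : z <> v by move=> zv; apply: ft; rewrite -Dt /= -zv.
have zv' : z' <> v by move=> zv'; apply: ft'; rewrite -Dt /= -zv'.
have ev : ends e v by have : [set e | ends e v] e by rewrite Dt.
have [u [w he]] := ends_pair e.
by move: ev ez ez' zv zv'; rewrite he => -[->|->] [->|->] [->|->].
Qed.

(* A component with fewer than l edges is a forest, hence has more vertices than
   edges, and each of these vertices has degree more than l. *)
Lemma component_darts X r : atleast l X -> incident_vertices setT r ->
  atleast l.+1 [set d : edge G * vertex G |
    [/\ X d.1, ends d.1 d.2 & linked (~` X) r d.2]].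
Proof.
move=> Xl rV; set D := component (~` X) r.
have DX : X `<=` ~` D by move=> e Xe [].
have [Dl|] := pselect (atleast l D).
  (* Each of the [l + 1] boundary vertices of [D] is linked to [r] and has an edge outside [D],
     which must then lie in [X]. *)
  have := large_boundary _ Dl (atleast_sub DX Xl); rewrite l_gt0 leqnn => /(_ isT).
  apply: (@atleast_rel _ _ _ _ _ (fun v d => d.2 = v)); last by move=> v v' d _ _ <- <-.
  move=> v [[e De ev] [f Df fv]]; have rv := component_ends De ev.
  exists (f, v) => //; split=> //=; apply: contrapT => Xf; apply: Df.
  by split=> //; exists v.
move=> /not_atleast[t [ut tl Dt]].
have [s [us ss sr]] : exists s, [/\ uniq s, size s = (size t).+1 &
    forall v, v \in s -> linked (~` X) r v].
  (* Without edges there is the vertex [r] alone. Otherwise [t] is a forest, since cycles have more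
     than [l] edges and [t] has fewer. *)
  case tE: t => [|e t'].
    by exists [:: r]; split=> // v; rewrite inE => /eqP ->; exact: linked_refl.
  have [|||s [us ss _ sV]] := @acyclic_atleast _ set0 t (size t') ut.
  - by rewrite tE.
  - by move=> f _ [].
  - rewrite set0U => -[x [p [cp]]]; have [_ _ _ _ ue] := cp.
    have := girth cp; rewrite -(size_map fst) => lp /(uniq_leq_size ue).
    by move=> /(leq_trans lp); rewrite ltnNge ltnW.
  exists s; split=> //; move=> v /sV[f]; rewrite -Dt; exact: component_ends.
have := @atleast_bigU _ _ l.+1 s (fun v d => ends d.1 v /\ d.2 = v) us.
have sd v : v \in s -> atleast l.+1 [set d : edge G * vertex G | ends d.1 v /\ d.2 = v].
  move=> /sr rv; have : incident_vertices setT v.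
    case: rv => p [wp <-]; case/lastP: p wp => [//|p [e z]].
    rewrite -cats1 walk_cat /= => -[_ [he _]] _; exists e => //.
    by rewrite he /unzip2 map_cat last_cat /=; right.
  move=> /degree; apply: (@atleast_rel _ _ _ _ _ (fun e d => d = (e, v))).
    by move=> e ev; exists (e, v).
  by move=> e e' d _ _ -> [].
move=> /(_ sd) H.
(* There are [(size t + 1)(l + 1)] darts at [s]. At most [2 * size t] of them lie on edges of [D];
   as [l >= 1], at least [l + 1] remain, all on edges of [X]. *)
have {H} H : atleast (l.+1 + (size t).*2) [set d : edge G * vertex G |
    exists2 v, v \in s & ends d.1 v /\ d.2 = v].
  apply: atleast_le (H _); first by rewrite ss; nia.
  by move=> v v' d _ _ [_ <-] [_ <-].
have nd : ~ atleast (size t).*2.+1 [set d : edge G * vertex G | d.1 \in t /\ ends d.1 d.2].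
  by move=> /darts_bound; rewrite ltnn.
apply: atleast_sub (atleast_setD H nd) => -[e v] [[w /= /sr rv [ev vw]] /= h].
rewrite -{}vw in rv ev.
split=> //; apply: contrapT => Xe; apply: h; split=> //.
have : D e by split=> //; exists v.
by rewrite Dt.
Qed.

(** By [degree] a second edge meets [u]. If [e] were a bridge, the component of [u] without [e]
    would have boundary at most [u], against [large_boundary] for [m = 1]. *)
Lemma no_bridge e u v : ends e = [set u; v] -> linked (~` [set e]) u v.
Proof.
move=> he; apply: contrapT => nuv.
have eu : ends e u by rewrite he; left.
have uV : incident_vertices setT u by exists e.
have De : atleast 2 [set e | ends e u] by apply: atleast_le (degree uV).
have [f [fu fe]] := atleast_nonempty (atleast_del e De).
set P := component (~` [set e]) u.
have Pf : P f by split=> //; exists u => //; exact: linked_refl.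
have Pe : ~ P e by case=> + _; apply.
have := large_boundary _ (atleast1 Pf) (@atleast1 _ (~` P) e Pe).
rewrite l_gt0 => /(_ isT) /(@atleast_sub _ _ _ [set` [:: u]]) h.
suff /h /atleast_size : boundary P `<=` [set` [:: u]] by [].
move=> z [[g Pg gz] [g' Pg' g'z]]; have uz := component_ends Pg gz.
have ge : g' = e by apply: contrapT => g'e; apply: Pg'; split=> //; exists z.
move: g'z; rewrite ge he => -[->|zv]; first by rewrite /= mem_head.
by case: nuv; rewrite -zv.
Qed.

Lemma acyclic_side_compl_ge X B B' F : atleast l X -> atleast l (~` X) ->
  base_of M X B -> base_of M (~` X) B' -> F `<=` B `|` B' ->
  base M ((B `|` B') `\` F) -> acyclic X -> atleast l F.
Proof.
move=> Xl Yl bB bB' FB bF acX.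
have BX : X = B by case: bB => -[_ BX] maxB; apply: maxB => //; split.
have [[acB' B'X] _] := bB'.
have B'B : B' `<=` B `|` B' by move=> e; right.
have [F0 [F0B bT FF0]] := base_compl bB bB' FB bF B'B acB'.
apply/FF0; apply: contrapT => /not_atleast[s [us sl F0s]].
have sX e : e \in s -> X e.
  move=> es; have /F0B[[|//] nB'] : F0 e by rewrite F0s.
  by rewrite BX.
set T := (B `|` B') `\` F0 in bT.
have TX e : X e -> e \notin s -> T e.
  by move=> Xe es; split; [left; rewrite -BX|rewrite F0s; apply/negP].
have B'T : B' `<=` T by move=> e B'e; split; [right|move=> /F0B[_]; apply].
have [acT _] := bT.
have [t [ut Xt]] : exists t, uniq t /\ X = [set` t].
  (* The edges of s close finitely many T-cycles with a finite union of edges w;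
     an edge of X in T outside w would be a bridge. *)
  have [w wT ws] : exists2 w : seq (edge G), {in w, forall e, T e} &
      forall e u v, e \in s -> ends e = [set u; v] -> linked [set` w] u v.
    elim: (s) => [|e s' [w wT ws]]; first by exists [::].
    have [u [v he]] := ends_pair e.
    have [p [wp lp pT]] : linked T u v.
      by apply: (base_linked bT); apply: linked_edge he.
    exists (unzip1 p ++ w) => [f|f u' v'].
      by rewrite mem_cat => /orP[/pT|/wT].
    rewrite inE => /orP[/eqP ->|fs hf].
      have puv : linked [set` unzip1 p ++ w] u v.
        by exists p; split=> // g gp; rewrite /= mem_cat; apply/orP; left.
      rewrite he => /set2_inj[[<- <-]//|[<- <-]]; exact: linked_sym.
    apply: linked_sub (ws f u' v' fs hf) => g gw /=.
    by rewrite mem_cat; apply/orP; right.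
  have [Xsw|] := pselect (X `<=` [set` s ++ w]); last first.
    move=> /existsNP[e /not_implyP[Xe /= /negP]]; rewrite mem_cat negb_or => /andP[es ew].
    have [u [v he]] := ends_pair e.
    have := no_bridge he => uv; exfalso.
    apply: (@acyclic_unlinked _ (T `\` [set e]) e u v) => //; first by case=> _; apply.
      by apply: acyclic_sub acT _ => f [[]//|->]; exact: TX.
    have wTe : [set` w] `<=` T `\` [set e].
      by move=> f fw; split; [exact: wT|move=> /= fe; move: ew; rewrite -fe fw].
    apply: linked_base uv => f x y /= fe hf.
    have fx : ends f x by rewrite hf; left.
    have fy : ends f y by rewrite hf; right.
    have [Xf|Xf] := pselect (X f).
      have [fs|fs] := boolP (f \in s); first exact: linked_sub wTe (ws _ _ _ fs hf).
      by apply: (linked_ends _ fx fy); split=> //; exact: TX.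
    apply: linked_sub (base_of_linked_ends bB' Xf fx fy) => g B'g; split; first exact: B'T.
    by move=> /= ge; apply: (B'X _ B'g); rewrite ge.
  have [|t [ut _ Xt]] := @not_atleast _ (size (s ++ w)).+1 X; last by exists t.
  by move=> /(atleast_sub Xsw) /atleast_size; rewrite ltnn.
(* The edges of [X] that lie in [T]. *)
pose t0 := filter (predC (mem s)) t.
have ut0 : uniq t0 by exact: filter_uniq.
have tt0 : (size t <= size t0 + size s)%N.
  have : (size (filter (mem s) t) <= size s)%N.
    apply: uniq_leq_size; first exact: filter_uniq.
    by move=> e; rewrite mem_filter => /andP[].
  have := count_predC (mem s) t; rewrite -!size_filter -/t0; lia.
have lt : (l <= size t)%N by apply: atleast_size; rewrite -Xt.
have [n t0n] : exists n, size t0 = n.+1 by exists (size t0).-1; lia.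
have t0X e : e \in t0 -> X e /\ e \notin s.
  by rewrite mem_filter Xt => /andP[].
have [||r [ur rn unl rV]] := @acyclic_atleast _ B' t0 n ut0 t0n.
- by move=> e /t0X[Xe _] /B'X.
- by apply: acyclic_sub acT _ => e [/B'T//|/t0X[]]; exact: TX.
have := @atleast_bigU _ _ l.+1 r (fun v d => [/\ X d.1, ends d.1 d.2 & linked (~` X) v d.2]) ur.
case.
- move=> v /rV[e _ ev]; apply: component_darts => //; by exists e.
- move=> v v' d vr v'r [_ _ vd] [_ _ v'd]; apply: unl => //.
  apply: (@linked_trans _ _ d.2); first exact: base_of_linked bB' vd.
  by apply: linked_sym; exact: base_of_linked bB' v'd.
move=> ds [uds sds dsX].
have : atleast (size r * l.+1) [set d : edge G * vertex G | d.1 \in t /\ ends d.1 d.2].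
  exists ds; split=> // d /dsX[v _ [Xd vd _]]; split=> //.
  by move: Xd; rewrite Xt.
(* From [size t0 = n + 1] and [size s <= l - 1] follows [size t <= n + l], while
   [(n + 2)(l + 1) > 2 (n + l)] because [n l >= n]. *)
have tn : ((size t).*2 <= (n + l).*2)%N by rewrite leq_double; lia.
move=> /darts_bound /leq_trans/(_ tn).
have := leq_pmulr n l_gt0; rewrite rn !mulSn mulnS; lia.
Qed.

Lemma cycle_component x p X : is_cycle x p -> walk_edges p `<=` X ->
  atleast l (component X x).
Proof.
move=> cp pX; have [wp _ _ _ ue] := cp.
apply: (@atleast_le _ _ (size (unzip1 p))); first by rewrite size_map; exact: ltnW (girth cp).
exists (unzip1 p); split=> // e ep; split; first exact: pX.
case: cp => + _ _ _ _; elim: p x {wp ue} pX ep => [//|[f y] p IH] x pX ep [he wp].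
have Xf : X f by apply: pX; rewrite /walk_edges /= mem_head.
move: ep; rewrite inE => /orP[/eqP ->|ep].
  by exists x; [rewrite he; left|exact: linked_refl].
have [|v ev yv] := IH y _ ep wp.
  by move=> g gp; apply: pX; rewrite /walk_edges /= inE; apply/orP; right.
by exists v => //; apply: linked_trans (linked_edge Xf he) yv.
Qed.

Lemma cyclic_sides_compl_ge X B B' F :
  base_of M X B -> base_of M (~` X) B' -> F `<=` B `|` B' ->
  base M ((B `|` B') `\` F) -> ~ acyclic X -> ~ acyclic (~` X) -> atleast l F.
Proof.
move=> bB bB' FB bF /contrapT[x [p [cp pX]]] /contrapT[y [q [cq qX]]].
have [[acB BX] _] := bB; have [[acB' B'X] _] := bB'.
set C := component X x; set K := component (~` C) y.
have CX : C `<=` X by exact: component_sub.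
have Kl : atleast l K.
  by apply: cycle_component cq _ => e /qX Xe /CX.
have KCl : atleast l (~` K).
  by apply: atleast_sub (cycle_component cp pX) => e Ce [].
have := large_boundary _ Kl KCl; rewrite l_gt0 leqnn => /(_ isT)[s [us ss sK]].
have BC_B : B `&` C `<=` B `|` B' by move=> e [Be _]; left.
have acBC : acyclic (B `&` C) by apply: acyclic_sub acB _ => e [].
have [F0 [F0B bT FF0]] := base_compl bB bB' FB bF BC_B acBC.
set T := (B `|` B') `\` F0 in bT; have [acT _] := bT.
(* A boundary vertex of [K] has an edge outside [K]; this edge is in [C], as otherwise it would
   belong to [K]. *)
have xs v : v \in s -> linked (B `&` C) x v.
  move=> /sK[[e Ke ev] [f Kf fv]]; have yv := component_ends Ke ev.
  have Cf : C f by apply: contrapT => Cf; apply: Kf; split=> //; exists v.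
  have xv : linked B x v := base_of_linked bB (component_ends Cf fv).
  apply: linked_sub (linked_component xv) => g [Bg [w gw xw]]; split=> //.
  by split; [exact: BX|exists w => //; exact: linked_sub BX xw].
(* For an edge of [X] outside [C], the connection of its ends in [B] avoids [C], as otherwise the
   edge would belong to [C]. *)
have ys v : v \in s -> linked ((B `|` B') `\` C) y v.
  move=> /sK[[e Ke ev] _]; apply: linked_base (component_ends Ke ev) => f a b Cf hf.
  have fa : ends f a by rewrite hf; left.
  have fb : ends f b by rewrite hf; right.
  have [Xf|Xf] := pselect (X f); last first.
    apply: linked_sub (base_of_linked_ends bB' Xf fa fb) => g B'g; split; first by right.
    by move=> /CX; exact: B'X.
  have ab := base_of_linked_ends bB Xf fa fb.
  apply: linked_sub (linked_component ab) => g [Bg [w gw aw]]; split; first by left.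
  move=> Cg; apply: Cf; split=> //; exists a => //.
  apply: linked_trans (component_ends Cg gw) _; apply: linked_sym.
  exact: linked_sub BX aw.
(* In the forest [T], vertices linked inside [C] cannot also be linked outside [C]; only the edges
   of [F0] restore these links, and [l + 1] vertices need [l] of them. *)
apply/FF0; apply: (@unlinked_atleast _ (T `\` C) _ s) => // u v us' vs.
- apply: (@acyclic_disjoint_linked _ (B `&` C)).
  + apply: acyclic_sub acT _ => e [[Be Ce]|[]//].
    by split; [left|move=> /F0B[_]; apply].
  + by apply/seteqP; split=> // e [[_ Ce] [_]].
  + exact: linked_trans (linked_sym (xs u us')) (xs v vs).
- have uv := linked_trans (linked_sym (ys u us')) (ys v vs).
  apply: linked_sub uv => e [Be Ce].
  by have [|F0e] := pselect (F0 e); [right|left; split].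
Qed.

End NoSmallTutteSeparation.

(** * From Tutte-connectivity to matroid connectivity, and the equivalence *)

Lemma Tutte_matroid_connected (k : int) (G : graph) :
  Tutte_connected G k -> connected_matroid (finite_cycle_matroid G) k.
Proof.
move=> Gk l lk [X [Y [[X0 Y0 XY XY0] kX Xl Yl]]].
have YX : Y = ~` X.
  apply/seteqP; split=> e; first by move=> Ye Xe; have : (X `&` Y) e by []; rewrite XY0.
  by move=> Xe; have : (X `|` Y) e by [rewrite XY]; case.
rewrite {}YX {Y XY XY0} in Y0 Yl.
have [B [B' [F [bB bB' FB bF Fl]]]] := kappa_le_witness (ltry _) kX.
case: l lk Xl Yl Fl {kX} => [[|l]|l] lk.
- by move=> _ _ /(le_trans (ecard_ge0 _)).
- move=> /atleast_ecard Xl /atleast_ecard Yl.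
  have -> : (l.+1%:Z - 1 = l%:Z)%R by lia.
  move=> /ecard_le; apply.
  have large_bd m P : (0 < m <= l.+1)%N -> atleast m P -> atleast m (~` P) ->
      atleast m.+1 (@boundary G P).
    case: m => // m ml Pm PCm; apply: contrapT => /ecard_le bP; apply: (Gk (Posz m.+1)).
      by apply: le_lt_trans lk; rewrite lez_nat.
    exists P, (~` P); split=> //; try exact/atleast_ecard.
    by split; [exact: atleast_nonempty Pm|exact: atleast_nonempty PCm|exact: setUCr|exact: setICr].
  have edges_ge : atleast (l.+1 + l.+1) [set: edge G].
    have [s [us ss sX]] := Xl; have [t [ut st tX]] := Yl.
    exists (s ++ t); split=> //; last by rewrite size_cat ss st.
    rewrite cat_uniq us ut andbT; apply/hasPn => e /tX Xe; apply/negP => /sX //.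
  have [acX|cycX] := pselect (acyclic X).
    exact: (acyclic_side_compl_ge _ large_bd edges_ge Xl Yl bB bB' FB bF).
  have [acY|cycY] := pselect (acyclic (~` X)).
    (* The acyclic case again, with the two sides exchanged. *)
    rewrite setUC in FB bF; rewrite -(setCK X) in Xl bB.
    exact: (acyclic_side_compl_ge _ large_bd edges_ge Yl Xl bB' bB FB bF).
  exact: (cyclic_sides_compl_ge _ large_bd edges_ge bB bB' FB bF).
- by move=> _ _ /(le_trans (ecard_ge0 _)).
Qed.

Theorem theorem1 (k : int) (G : graph) :
  (2 <= k)%R -> finitely_separable G ->
  (Tutte_connected G k <-> connected_matroid (finite_cycle_matroid G) k).
Proof.
move=> k2 _; split; first exact: Tutte_matroid_connected.
exact: matroid_Tutte_connected.
Qed.
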